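(* Let $\mathbb{K}\in\{\mathbb{R},\mathbb{C}\}$, let $V$ be a finite-dimensional $\mathbb{K}$-vector space with a fundamental tensor $g$ of arbitrary signature and an orthonormal basis $\mathcal{B}=\{n_1,\dots,n_d\}$ with respect to $g$. Let $r,l$ be integers with $2\le 2l\le r$, let $b_0\in\mathcal{B}^{r-2l}$ (with $b_0=\emptyset$ if $r=2l$), and let $e\in\mathbb{K}[\mathcal{S}_r]$ be an idempotent, $\mathfrak{l}:=\mathbb{K}[\mathcal{S}_r]\cdot e$. Consider the partition $\lambda_0:=(2^l,1^{r-2l})\vdash r$ and the lexicographically smallest standard tableau $t$ of $\lambda_0$ (its rows are $\{1,2\},\{3,4\},\dots,\{2l-1,2l\},\{2l+1\},\dots,\{r\}$). Let $\mathcal{H}_t$ be the group of horizontal permutations of $t$ and $Q\subset\mathcal{V}_t$ the subgroup of those vertical permutations of $t$ which only permute full rows of length $2$ of $t$ (i.e. $Q=\{q\in\mathcal{S}_r\mid \exists s\in\mathcal{S}_l:\ q(2k-1)=2s(k)-1,\ q(2k)=2s(k)\ (1\le k\le l),\ q(j)=j\ (j>2l)\}$), and put $G:=\mathcal{H}_t\cdot Q$ and $1_G:=\sum_{g\in G}g$. Then every tensor $T\in\mathcal{T}_{\mathfrak{l}^{\ast}}\subseteq\mathcal{T}_rV$ fulfils $$\sum_{b\in\mathfrak{B}_{b_0}}\gamma_b\,T_b\in 1_G\cdot\mathbb{K}[\mathcal{S}_r]\cdot e.$$ Furthermore, if $\dim V\ge r-l$, then there is a $b_0\in\mathcal{B}^{r-2l}$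 such that $$1_G\cdot\mathbb{K}[\mathcal{S}_r]\cdot e=\mathcal{L}_{\mathbb{K}}\Big\{\sum_{b\in\mathfrak{B}_{b_0}}\gamma_b\,T_b\ \Big|\ T\in\mathcal{T}_{\mathfrak{l}^{\ast}}\Big\},$$ where $\mathcal{L}_{\mathbb{K}}$ denotes linear span.
   Context: $\mathcal{T}_rV$ is the space of $r$-times covariant tensors (multilinear maps $V^r\to\mathbb{K}$). A fundamental tensor $g$ is a nondegenerate symmetric bilinear form on $V$; $\mathcal{B}$ orthonormal means $g(n_i,n_j)=0$ for $i\neq j$ and $g(n_i,n_i)\in\{1,-1\}$. $\mathcal{S}_r$ is the symmetric group with product $(p\circ q)(i)=p(q(i))$; $\mathbb{K}[\mathcal{S}_r]$ its group ring. Elements $a=\sum_p a(p)p$ act on tensors by $(aT)(v_1,\dots,v_r)=\sum_p a(p)T(v_{p(1)},\dots,v_{p(r)})$; $a^{\ast}:=\sum_p a(p)p^{-1}$, and $\mathfrak{l}^{\ast}=\{a^\ast\mid a\in\mathfrak{l}\}=e^{\ast}\cdot\mathbb{K}[\mathcal{S}_r]$ is a right ideal. The symmetry class is $\mathcal{T}_{\mathfrak{l}^{\ast}}:=\{aT\mid a\in\mathfrak{l}^{\ast},\ T\in\mathcal{T}_rV\}=\{T\mid e^{\ast}T=T\}$. For $b=(v_1,\dots,v_r)\in V^r$, $T_b:=\sum_{p\in\mathcal{S}_r}T(v_{p(1)},\dots,v_{p(r)})\,p$. For $b_0=(v_{2l+1},\dots,v_r)$, $\mathfrak{B}_{b_0}:=\{(w_1,w_1,w_2,w_2,\dots,w_l,w_l,v_{2l+1},\dots,v_r)\in\mathcal{B}^r\mid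 (w_1,\dots,w_l)\in\mathcal{B}^l\}$ (for $r=2l$, $b_0=\emptyset$ and the tuples are $(w_1,w_1,\dots,w_l,w_l)$), and for such $b$, $\gamma_b:=\prod_{i=1}^l g(w_i,w_i)\in\{1,-1\}$. Horizontal (vertical) permutations of a Young tableau are those permutations mapping each row (column) set of the tableau to itself. *)

(* Defs.v *)
From HB Require Import structures.
From mathcomp Require Import all_boot all_order all_algebra all_fingroup.
From mathcomp Require Import sesquilinear complex.
From mathcomp Require Import boolp classical_sets reals.

Set Implicit Arguments.
Unset Strict Implicit.
Unset Printing Implicit Defensive.

Import GRing.Theory.

Local Open Scope ring_scope.

(* MathComp composes permutations from left to right, (s * t)%g i = t (s i),
   whereas here (p o q)(i) = p (q i). *)
Definition perm_comp (r : nat) (p q : 'S_r) : 'S_r := (q * p)%g.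

Lemma perm_compE (r : nat) (p q : 'S_r) (i : 'I_r) :
  perm_comp p q i = p (q i).
Proof. by rewrite /perm_comp permM. Qed.

(* The group ring K[S_r]: an element is its coefficient function. The product
   is the convolution for perm_comp, not the pointwise one; the alias keeps
   the pointwise product of {ffun _ -> _} out of the way. *)
Definition group_ringS (K : fieldType) (r : nat) := {ffun 'S_r -> K^o}.

HB.instance Definition _ (K : fieldType) (r : nat) :=
  Vector.copy (group_ringS K r) {ffun 'S_r -> K^o}.

Section GroupRing.
Variables (K : fieldType) (r : nat).
Local Notation A := (group_ringS K r).
Implicit Types (a b c : A) (p q s : 'S_r).

Definition perm_elt p : A := [ffun s => (s == p)%:R].

(* (a b)(s) = \sum_(p o q = s) a(p) b(q), solved for q = p^-1 o s *)
Definition gr_mul a b : A :=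
  [ffun s => \sum_p (a p : K) * b (perm_comp p^-1 s)].

Definition gr_one : A := perm_elt 1%g.

Lemma gr_mulA : associative gr_mul.
Proof.
move=> a b c; apply/ffunP => s; rewrite !ffunE.
under eq_bigr do rewrite ffunE big_distrr /=.
under [RHS]eq_bigr do rewrite ffunE big_distrl /=.
rewrite [RHS]exchange_big /=; apply: eq_bigr => p _.
rewrite [RHS](reindex (perm_comp p)) /=; last first.
  by exists (perm_comp p^-1) => q _; rewrite /perm_comp ?mulgK ?mulgKV.
apply: eq_bigr => q _; rewrite mulrA.
by rewrite /perm_comp mulgK invMg mulgA.
Qed.

Lemma gr_mul1l : left_id gr_one gr_mul.
Proof.
move=> a; apply/ffunP => s; rewrite ffunE (bigD1 1%g) //= big1 => [|p /negPf p1].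
  by rewrite ffunE eqxx mul1r addr0 /perm_comp invg1 mulg1.
by rewrite ffunE p1 mul0r.
Qed.

Lemma gr_mul1r : right_id gr_one gr_mul.
Proof.
move=> a; apply/ffunP => s; rewrite ffunE (bigD1 s) //= big1 => [|p /negPf ps].
  by rewrite ffunE /perm_comp mulgV eqxx mulr1 addr0.
by rewrite ffunE /perm_comp -eq_mulgV1 eq_sym ps mulr0.
Qed.

Lemma gr_mulDl : left_distributive gr_mul +%R.
Proof.
move=> a b c; apply/ffunP => s; rewrite !ffunE -big_split /=.
by apply: eq_bigr => p _; rewrite ffunE mulrDl.
Qed.

Lemma gr_mulDr : right_distributive gr_mul +%R.
Proof.
move=> a b c; apply/ffunP => s; rewrite !ffunE -big_split /=.
by apply: eq_bigr => p _; rewrite ffunE mulrDr.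
Qed.

Lemma gr_one_neq0 : gr_one != 0.
Proof.
by apply/eqP => /ffunP/(_ 1%g)/eqP; rewrite !ffunE eqxx oner_eq0.
Qed.

HB.instance Definition _ := GRing.Zmodule_isNzRing.Build (group_ringS K r)
  gr_mulA gr_mul1l gr_mul1r gr_mulDl gr_mulDr gr_one_neq0.

Lemma gr_scaleAl (k : K) a b : k *: (a * b) = k *: a * b.
Proof.
apply/ffunP => s; rewrite !ffunE [LHS]big_distrr /=.
by apply: eq_bigr => p _; rewrite ffunE -mulrA.
Qed.

HB.instance Definition _ :=
  GRing.Lmodule_isLalgebra.Build K (group_ringS K r) gr_scaleAl.

Lemma gr_scaleAr (k : K) a b : k *: (a * b) = a * (k *: b).
Proof.
apply/ffunP => s; rewrite !ffunE [LHS]big_distrr /=.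
by apply: eq_bigr => p _; rewrite ffunE [LHS]mulrCA.
Qed.

HB.instance Definition _ :=
  GRing.Lalgebra_isAlgebra.Build K (group_ringS K r) gr_scaleAr.

Lemma perm_eltM p q : perm_elt p * perm_elt q = perm_elt (perm_comp p q).
Proof.
apply/ffunP => s; rewrite ffunE (bigD1 p) //= big1 => [|p' /negPf pp'].
  rewrite !ffunE eqxx mul1r addr0 /perm_comp; congr (nat_of_bool _)%:R.
  by apply/eqP/eqP => [<-|->]; rewrite ?mulgKV ?mulgK.
by rewrite ffunE pp' mul0r.
Qed.

Lemma group_ringSE a : a = \sum_p (a p : K) *: perm_elt p.
Proof.
apply/ffunP => s; rewrite sum_ffunE (bigD1 s) //= big1 => [|p /negPf ps].
  by rewrite !ffunE eqxx addr0 [RHS]mulr1.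
by rewrite !ffunE eq_sym ps [LHS]mulr0.
Qed.

Definition gr_star a : A := \sum_p (a p : K) *: perm_elt p^-1.

Definition left_ideal (e : A) : set A := [set a * e | a in [set: A]]%classic.

Definition star_ideal (e : A) : set A :=
  [set gr_star a | a in left_ideal e]%classic.

Definition set_elt (G : {set 'S_r}) : A := \sum_(p in G) perm_elt p.

End GroupRing.

Definition linear_span (K : fieldType) (E : lmodType K) (S : set E) : set E :=
  [set x | exists n (c : 'I_n -> K) (y : 'I_n -> E),
     (forall i, S (y i)) /\ x = \sum_(i < n) c i *: y i]%classic.

Section Tensors.
Variables (K : fieldType) (V : vectType K) (r : nat).
Implicit Types (T : r.-tuple V -> K) (v : r.-tuple V).

Definition set_arg v (i : 'I_r) (u : V) : r.-tuple V :=
  [tuple if j == i then u else tnth v j | j < r].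

Definition tensors : set (r.-tuple V -> K) :=
  [set T | forall v i, scalar (fun u => T (set_arg v i u))]%classic.

Definition perm_args (p : 'S_r) v : r.-tuple V :=
  [tuple tnth v (p i) | i < r].

Definition gr_act (a : group_ringS K r) T : r.-tuple V -> K :=
  fun v => \sum_p (a p : K) * T (perm_args p v).

Definition symmetry_class (I : set (group_ringS K r)) :
    set (r.-tuple V -> K) :=
  [set gr_act a T | a in I & T in tensors]%classic.

Definition tensor_elt T v : group_ringS K r :=
  \sum_p T (perm_args p v) *: perm_elt K p.

End Tensors.

Section Bases.
Variables (K : fieldType) (V : vectType K) (g : {symmetric V}).
Variables (d : nat) (B : d.-tuple V).

Definition orthonormal_basis : Prop :=
  [/\ basis_of {:V} B,
      forall i j, i != j -> g (tnth B i) (tnth B j) = 0 &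
      forall i, g (tnth B i) (tnth B i) = 1 \/ g (tnth B i) (tnth B i) = -1].

Variables (r l : nat).

(* Tuples of vectors of the basis are given by the tuples of their indices. *)
Definition basis_vectors (b : r.-tuple 'I_d) : r.-tuple V :=
  [tuple tnth B (tnth b i) | i < r].

Definition paired_tuples (b0 : (r - 2 * l).-tuple 'I_d) :
    {set r.-tuple 'I_d} :=
  [set b : r.-tuple 'I_d | [exists w : l.-tuple 'I_d,
     tval b == flatten [seq [:: i; i] | i <- w] ++ b0]].

(* In b = (w_1, w_1, ..., w_l, w_l, ...), counting positions from 0, w_k stands
   at the k-th even position. *)
Definition pair_sign (b : r.-tuple 'I_d) : K :=
  \prod_(i < r | (i < 2 * l)%N && ~~ odd i)
     g (tnth B (tnth b i)) (tnth B (tnth b i)).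

Definition contracted_elt (b0 : (r - 2 * l).-tuple 'I_d)
    (T : r.-tuple V -> K) : group_ringS K r :=
  \sum_(b in paired_tuples b0) pair_sign b *: tensor_elt T (basis_vectors b).

End Bases.

Section Tableau.
Local Open Scope nat_scope.
Variables (r : nat).

(* A tableau is the sequence of its rows; entries are counted from 0. *)
Definition tableau := seq (seq 'I_r).

Definition horizontal_perms (t : tableau) : {set 'S_r} :=
  [set p : 'S_r | all (fun row => p @: [set i in row] == [set i in row]) t].

Variable l : nat.

Definition lambda0 : seq nat := nseq l 2 ++ nseq (r - 2 * l) 1.

(* The standard tableau of shape lambda0 whose rows, read one after the other,
   list the entries in increasing order: this is the least possible reading. *)
Definition tableau0 : tableau := reshape lambda0 (enum 'I_r).

(* The permutations of the full rows of length 2, a subgroup of the vertical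
   permutations: counting from 0, 2 * k and 2 * k + 1 form the k-th row. *)
Definition row_perms : {set 'S_r} :=
  [set q : 'S_r | [exists s : 'S_l,
     [forall k : 'I_l, forall i : 'I_r,
        ((i == 2 * k :> nat) ==> (q i == 2 * s k :> nat)) &&
        ((i == (2 * k).+1 :> nat) ==> (q i == (2 * s k).+1 :> nat))]
     && [forall i : 'I_r, (2 * l <= i) ==> (q i == i)]]].

Definition group_G : {set 'S_r} :=
  [set perm_comp h q | h in horizontal_perms tableau0, q in row_perms].

Lemma sumn_lambda0 : 2 * l <= r -> sumn lambda0 = r.
Proof. by move=> h; rewrite sumn_cat !sumn_nseq mul1n subnKC. Qed.

Lemma shape_tableau0 : 2 * l <= r -> shape tableau0 = lambda0.
Proof. by move=> h; rewrite reshapeKl // size_enum_ord sumn_lambda0. Qed.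

Lemma tableau0_reading : 2 * l <= r -> flatten tableau0 = enum 'I_r.
Proof. by move=> h; rewrite reshapeKr // size_enum_ord sumn_lambda0. Qed.

End Tableau.

(* Main.v *)
(* For p in G, the map b |-> b o p permutes the paired tuples ending in b0 and
   preserves gamma_b, hence p fixes C_T := \sum_b gamma_b T_b from the left and
   1_G C_T = #|G| C_T.  As C_(aT) = C_T a^*, the first claim follows.

   If dim V >= r - l, take for b* the tuple whose i-th entry is the basis vector
   indexed by the row of i in the tableau, and for b0 its tail.  Let T be the
   tensor with T (b) = 1 if b = b* and 0 for the other tuples of basis vectors.
   A permutation p admits a paired b with b o p = b* exactly when p is in G, and
   then b is unique with gamma_b = gamma_b*; so C_T = gamma_b* 1_G, and
   C_((a e)^* T) = gamma_b* 1_G a e. *)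

Require Import Defs.
From HB Require Import structures.
From mathcomp Require Import all_boot all_order all_algebra all_fingroup.
From mathcomp Require Import sesquilinear complex.
From mathcomp Require Import boolp classical_sets reals.
From mathcomp Require Import zify.

Set Implicit Arguments.
Unset Strict Implicit.
Unset Printing Implicit Defensive.

Import GRing.Theory.

Local Open Scope ring_scope.

(** * Coefficients in the group ring and the action on tensors *)

Section GroupRingTensors.
Variables (K : fieldType) (V : vectType K) (r : nat).
Implicit Types (a : group_ringS K r) (T : r.-tuple V -> K) (v : r.-tuple V).

Lemma tensor_eltE T v p : tensor_elt T v p = T (perm_args p v).
Proof.
rewrite /tensor_elt sum_ffunE (bigD1 p) //= big1 => [|q /negPf qp].
  by rewrite !ffunE eqxx addr0 [LHS]mulr1.
by rewrite !ffunE eq_sym qp [LHS]mulr0.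
Qed.

Lemma gr_starE a p : gr_star a p = a p^-1%g.
Proof.
rewrite /gr_star sum_ffunE (bigD1 p^-1%g) //= big1 => [|q qp].
  by rewrite !ffunE invgK eqxx addr0 [LHS]mulr1.
rewrite !ffunE; case: (p =P q^-1%g) qp => [->|_ _]; first by rewrite invgK eqxx.
by rewrite [LHS]mulr0.
Qed.

Lemma gr_starK : involutive (@gr_star K r).
Proof. by move=> a; apply/ffunP => p; rewrite !gr_starE invgK. Qed.

Lemma perm_args_comp p q v :
  perm_args q (perm_args p v) = perm_args (perm_comp p q) v.
Proof. by apply: eq_from_tnth => i; rewrite !tnth_mktuple permM. Qed.

(** The coefficient at s evaluates T at the arguments permuted by [perm_comp s q], weighted by
    [a q]. Summing over [perm_comp s q] instead of q gives a convolution with the inverse of q,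
    hence the star and the right-hand factor. *)
Lemma tensor_elt_act a T v :
  tensor_elt (gr_act a T) v = tensor_elt T v * gr_star a.
Proof.
apply/ffunP => s; rewrite tensor_eltE ffunE /gr_act.
rewrite [RHS](reindex (perm_comp s)) /=; last first.
  by exists (perm_comp s^-1) => q _; rewrite /perm_comp ?mulgK ?mulgKV.
apply: eq_bigr => q _; rewrite perm_args_comp tensor_eltE gr_starE mulrC.
by congr (_ * a _); rewrite /perm_comp invMg invgK mulgK.
Qed.

Lemma perm_elt_mulE p a s : (perm_elt K p * a) s = a (perm_comp p^-1 s).
Proof.
rewrite ffunE (bigD1 p) //= big1 => [|q /negPf qp].
  by rewrite ffunE eqxx mul1r addr0.
by rewrite ffunE qp mul0r.
Qed.

Lemma set_eltE (G : {set 'S_r}) p : set_elt K G p = (p \in G)%:R.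
Proof.
rewrite /set_elt sum_ffunE; case: (boolP (p \in G)) => [pG|pG].
  rewrite (bigD1 p) //= big1 => [|q /andP[_ /negPf qp]].
    by rewrite ffunE eqxx addr0.
  by rewrite ffunE eq_sym qp.
rewrite big1 // => q qG; rewrite ffunE.
by case: eqP qG pG => [->|//] ->.
Qed.

End GroupRingTensors.

(** * Rows of the tableau and the two kinds of permutations *)

Section Tableau0.
Local Open Scope nat_scope.

(* The index of the row of tableau0 containing i, counting from 0. *)
Definition row_index (l i : nat) : nat := if i < 2 * l then i./2 else i - l.

Variables (r l : nat) (hl : 2 * l <= r).
Implicit Types (h p q : 'S_r) (i j : 'I_r).

Lemma size_tableau0 : size (tableau0 r l) = r - l.
Proof.
by rewrite size_reshape size_cat !size_nseq; lia.
Qed.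

(** Row k is the segment of [enum 'I_r] starting at the sum of the first k row lengths: through
    [val] it is [iota (2 * k) 2] for [k < l] and [iota (l + k) 1] otherwise. *)
Lemma mem_tableau0 k i : k < r - l ->
  (i \in nth [::] (tableau0 r l) k) = (row_index l i == k).
Proof.
move=> kr; rewrite nth_reshape /lambda0 -(mem_map val_inj) map_take map_drop.
rewrite val_enum_ord nth_cat take_cat size_nseq /row_index.
case: ltnP => kl; rewrite ?sumn_cat !nth_nseq ?kl; last first.
  rewrite ifT; last by lia.
  rewrite take_nseq; last by lia.
  rewrite !sumn_nseq drop_iota take_iota mem_iota add0n.
  by case: i => i /=; case: ifP; lia.
rewrite take_nseq; last by lia.
rewrite sumn_nseq drop_iota take_iota mem_iota.
by case: i => i /=; case: ifP; lia.
Qed.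

Lemma row_index_lt i : row_index l i < r - l.
Proof. by rewrite /row_index; case: i => i /=; case: ifP; lia. Qed.

Lemma horizontal_permsP h :
  reflect (forall i, row_index l (h i) = row_index l i)
          (h \in horizontal_perms (tableau0 r l)).
Proof.
rewrite inE; apply: (iffP allP) => [hh i | hh x /(nthP [::]) [k]].
  have ri := row_index_lt i.
  have /hh/eqP/setP/(_ (h i)): nth [::] (tableau0 r l) (row_index l i)
      \in tableau0 r l by rewrite mem_nth ?size_tableau0.
  rewrite mem_imset ?inE; last exact: perm_inj.
  by rewrite !mem_tableau0 // eqxx => /esym/eqP.
rewrite size_tableau0 => kr <-.
rewrite eqEcard card_imset ?leqnn ?andbT; last exact: perm_inj.
apply/fintype.subsetP => _ /imsetP[i + ->].
by rewrite !inE !mem_tableau0 // hh.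
Qed.

(** Both parities and the tail fit one formula, since [i = 2 * i./2 + odd i] and [insub i./2]
    succeeds exactly when [i < 2 * l]. *)
Lemma row_permsP q : reflect
  (exists s : 'S_l, forall i, q i = (if insub i./2 is Some k
     then 2 * s k + odd i else i) :> nat)
  (q \in row_perms r l).
Proof.
rewrite inE; apply: (iffP existsP) => [[s /andP[/forallP qs /forallP qf]]|[s qs]];
  exists s.
  move=> i; case: insubP => [k kl /= ik|kl].
    have /forallP/(_ i)/andP[/implyP e0 /implyP e1] := qs k.
    case oi: (odd i); last by rewrite addn0; apply/eqP/e0/eqP; lia.
    by rewrite addn1; apply/eqP/e1/eqP; lia.
  by have /implyP qi := qf i; rewrite (eqP (qi _)) //; lia.
apply/andP; split; last first.
  apply/forallP => i; apply/implyP => li; apply/eqP/val_inj; rewrite /= qs.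
  by case: insubP => // k; lia.
apply/forallP => k; apply/forallP => i; rewrite qs.
have kl := ltn_ord k.
apply/andP; split; apply/implyP => /eqP ik;
  (case: insubP => [k' _ /= kk|]; last lia);
  (have -> : k' = k by apply: val_inj => /=; lia); by apply/eqP; lia.
Qed.

(** Clauses two and three keep the index range of [pair_sign] stable under q; the first and the last
    keep [b o q] paired with the same tail. *)
Lemma row_perms_index q : q \in row_perms r l ->
  [/\ forall i, 2 * l <= i -> q i = i,
      forall i, (q i < 2 * l) = (i < 2 * l),
      forall i, odd (q i) = odd i &
      forall i j, row_index l i = row_index l j ->
        row_index l (q i) = row_index l (q j)].
Proof.
case/row_permsP => s qs.
have qf i : 2 * l <= i -> q i = i.
  by move=> li; apply: val_inj; rewrite /= qs; case: insubP => // k; lia.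
split=> // [i|i|i j]; rewrite ?qs.
- by case: insubP => [k /= kl _|//]; have := ltn_ord (s k); case: (odd i); lia.
- by case: insubP => [k kl _|] //; case: (odd i); lia.
rewrite /row_index; case: insubP => [k kl /= ik|kl]; last first.
  case: insubP => [k' kl' /= ik'|kl']; do ?case: ifP; lia.
case: insubP => [k' kl' /= ik'|kl']; last by do ?case: ifP; lia.
have := ltn_ord (s k); have := ltn_ord (s k').
case: (ltnP i) => il; last lia; case: (ltnP j) => jl; last lia.
move=> ? ? ij; have -> : k' = k by apply: val_inj => /=; lia.
by case: (odd i); case: (odd j); do ?case: ifP; lia.
Qed.

End Tableau0.

(** * Paired tuples under permutation of positions *)

Section PairedTuples.
Local Open Scope nat_scope.
Variables (d r l : nat) (hl : 2 * l <= r) (b0 : (r - 2 * l).-tuple 'I_d).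
Implicit Types (b : r.-tuple 'I_d) (p q h : 'S_r).

Lemma nth_flatten_pairs (T : Type) (x0 : T) (w : seq T) n :
  nth x0 (flatten [seq [:: i; i] | i <- w]) n = nth x0 w n./2.
Proof. by elim: w n => [|x w IHw] [|[|n]] //=; rewrite ?nth_nil ?IHw. Qed.

Lemma size_flatten_pairs (T : Type) (w : seq T) :
  size (flatten [seq [:: i; i] | i <- w]) = 2 * size w.
Proof. by elim: w => //= x w ->; lia. Qed.

(** Trades the list w for two conditions on positions, constancy on rows and a prescribed tail,
    which can be followed through a permutation. *)
Lemma paired_tuplesP b : reflect
  ((forall i j : 'I_r, row_index l i = row_index l j -> tnth b i = tnth b j) /\
   (forall (i : 'I_r) (j : 'I_(r - 2 * l)), i = 2 * l + j :> nat ->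
      tnth b i = tnth b0 j))
  (b \in paired_tuples b0).
Proof.
rewrite inE; apply: (iffP existsP) => [[w /eqP bw]|[brow bb0]].
  (* ['I_d] may be empty, so the default value for [nth] is an entry of b. *)
  split=> i j ij; have x0 := tnth b i.
    rewrite !(tnth_nth x0) bw !nth_cat size_flatten_pairs size_tuple.
    rewrite !nth_flatten_pairs; move: ij; rewrite /row_index.
    by have := ltn_ord i; have := ltn_ord j;
      do 2!case: ifP => ?; move=> ? ? ?; congr (nth _ _ _); lia.
  rewrite !(tnth_nth x0) bw ij nth_cat size_flatten_pairs size_tuple ifF; last lia.
  by rewrite addKn.
have lr (k : 'I_l) : 2 * k < r by have := ltn_ord k; lia.
(* w collects the first entry of each pair. *)
have [w wE] : exists w : l.-tuple 'I_d,
    forall k, tnth w k = tnth b (Ordinal (lr k)).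
  by exists [tuple tnth b (Ordinal (lr k)) | k < l] => k; rewrite tnth_mktuple.
have sz : size (flatten [seq [:: i; i] | i <- w] ++ b0) == r.
  by rewrite size_cat size_flatten_pairs !size_tuple subnKC.
exists w; apply/eqP; apply: (congr1 val (_ : b = Tuple sz)).
apply: eq_from_tnth => i; have x0 := tnth b i.
rewrite [RHS](tnth_nth x0) /= nth_cat size_flatten_pairs size_tuple.
case: ltnP => il.
  have kl : i./2 < l by lia.
  rewrite nth_flatten_pairs -(tnth_nth x0 w (Ordinal kl)) wE.
  by apply: brow; rewrite /row_index /= il ifT; lia.
have jr : i - 2 * l < r - 2 * l by have := ltn_ord i; lia.
by rewrite -(tnth_nth x0 b0 (Ordinal jr)); apply: bb0; rewrite /= subnKC.
Qed.

Definition perm_indices p b : r.-tuple 'I_d := [tuple tnth b (p i) | i < r].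

Lemma perm_indices_inj p : injective (perm_indices p).
Proof.
move=> b b' /(congr1 (fun c => tnth c)) bb'; apply: eq_from_tnth => i.
by have := congr1 (@^~ (p^-1%g i)) bb'; rewrite !tnth_mktuple permKV.
Qed.

(** For [p = h o q] the factor h is absorbed because b is constant on rows, so [b o p = b o q]; q
    carries rows to rows and fixes the tail. *)
Lemma perm_indices_paired p b : p \in group_G r l -> b \in paired_tuples b0 ->
  perm_indices p b \in paired_tuples b0.
Proof.
case/imset2P=> h q /(horizontal_permsP hl) hh /(row_perms_index hl)[qf _ _ qr] ->.
case/paired_tuplesP => brow bb0.
have E i : tnth (perm_indices (perm_comp h q) b) i = tnth b (q i).
  by rewrite tnth_mktuple permM; apply: brow.
apply/paired_tuplesP; split=> i j ij; rewrite !E; first exact/brow/qr.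
by rewrite qf ?ij ?leq_addr //; apply: bb0.
Qed.

Lemma perm_indices_imset p : p \in group_G r l ->
  perm_indices p @: paired_tuples b0 = paired_tuples b0.
Proof.
move=> pG; apply/eqP; rewrite eqEcard card_imset ?leqnn ?andbT; last first.
  exact: perm_indices_inj.
by apply/fintype.subsetP => _ /imsetP[b bP ->]; apply: perm_indices_paired.
Qed.

End PairedTuples.

(** * Invariance of the contracted elements and the first claim *)

Section Contraction.
Variables (K : fieldType) (V : vectType K) (g : {symmetric V}).
Variables (d : nat) (B : d.-tuple V) (r l : nat) (hl : (2 * l <= r)%N).
Variable (b0 : (r - 2 * l).-tuple 'I_d).
Implicit Types (a : group_ringS K r) (T : r.-tuple V -> K) (b : r.-tuple 'I_d).
Implicit Types (p s : 'S_r).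

(** Again h is absorbed, and q permutes the even positions below [2 * l], hence only reorders the
    factors. *)
Lemma pair_sign_perm p b : p \in group_G r l -> b \in paired_tuples b0 ->
  pair_sign g B l (perm_indices p b) = pair_sign g B l b.
Proof.
case/imset2P=> h q /(horizontal_permsP hl) hh /(row_perms_index hl)[_ ql qo _] ->.
case/(paired_tuplesP hl) => brow _.
rewrite /pair_sign [RHS](reindex_inj (@perm_inj _ q)) /=.
apply: eq_big => i; first by rewrite ql qo.
by rewrite tnth_mktuple permM (brow _ _ (hh _)).
Qed.

Lemma basis_vectors_perm p b :
  basis_vectors B (perm_indices p b) = perm_args p (basis_vectors B b).
Proof. by apply: eq_from_tnth => i; rewrite !tnth_mktuple. Qed.

Lemma contracted_eltE T p : contracted_elt g B b0 T p =
  \sum_(b in paired_tuples b0)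
    pair_sign g B l b * T (basis_vectors B (perm_indices p b)).
Proof.
rewrite /contracted_elt sum_ffunE; apply: eq_bigr => b _.
by rewrite ffunE tensor_eltE basis_vectors_perm.
Qed.

Lemma contracted_elt_act a T : contracted_elt g B b0 (gr_act a T) =
  contracted_elt g B b0 T * gr_star a.
Proof.
rewrite /contracted_elt big_distrl; apply: eq_bigr => b _ /=.
by rewrite tensor_elt_act scalerAl.
Qed.

(** Left multiplication by p moves the coefficient at [p^-1 o s] to s. Summing over [b o p] in place
    of b preserves the signs and cancels [p^-1]. *)
Lemma perm_elt_contracted T p : p \in group_G r l ->
  perm_elt K p * contracted_elt g B b0 T = contracted_elt g B b0 T.
Proof.
move=> pG; apply/ffunP => s; rewrite perm_elt_mulE !contracted_eltE.
rewrite -{1}(perm_indices_imset hl b0 pG) big_imset /=; last first.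
  by move=> b c _ _; apply: perm_indices_inj.
apply: eq_bigr => b bP; rewrite (pair_sign_perm pG bP); congr (_ * T _).
rewrite !basis_vectors_perm perm_args_comp; congr (perm_args _ _).
by rewrite /perm_comp mulgKV.
Qed.

Lemma set_elt_contracted T :
  set_elt K (group_G r l) * contracted_elt g B b0 T =
  #|group_G r l|%:R *: contracted_elt g B b0 T.
Proof.
rewrite /set_elt big_distrl /= (eq_bigr _ (perm_elt_contracted T)).
by rewrite sumr_const scaler_nat.
Qed.

Lemma contracted_elt_in_ideal (e : group_ringS K r) T :
  #|group_G r l|%:R != 0 :> K -> symmetry_class (star_ideal e) T ->
  exists a, set_elt K (group_G r l) * a * e = contracted_elt g B b0 T.
Proof.
move=> nG [_ [_ [a _ <-] <-] [T' _ <-]].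
(* The tensor is [(a * e)^*] applied to T', so its contraction is [C_T' * a * e]; the scalar undoes
   the factor [#|G|] by which [1_G] multiplies [C_T']. *)
exists (#|group_G r l|%:R^-1 *: (contracted_elt g B b0 T' * a)).
rewrite contracted_elt_act gr_starK -scalerAr [set_elt _ _ * _]mulrA.
rewrite set_elt_contracted.
by rewrite -!scalerAl scalerA mulVf // scale1r mulrA.
Qed.

End Contraction.

(** Makes G nonempty, so that [#|G|] can be inverted in characteristic zero. *)
Lemma group_G1 (r l : nat) : (2 * l <= r)%N -> 1%g \in group_G r l.
Proof.
move=> hl; apply/imset2P; exists 1%g 1%g; last by rewrite /perm_comp mulg1.
  by apply/(horizontal_permsP hl) => i; rewrite perm1.
apply/(row_permsP hl); exists 1%g => i; rewrite perm1.
by case: insubP => //= k _ ik; rewrite perm1; lia.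
Qed.

(** * The tuple b* that separates the rows, and recognition of G *)

Section DistinctRows.
Local Open Scope nat_scope.
Variables (d r l : nat) (hl : 2 * l <= r) (hd : r - l <= d).

Definition row_tuple : r.-tuple 'I_d :=
  [tuple widen_ord hd (Ordinal (row_index_lt hl i)) | i < r].

Fact distinct_tail_subproof (j : 'I_(r - 2 * l)) : l + j < r - l.
Proof. by have := ltn_ord j; lia. Qed.

(** Position [2 * l + j] lies in row [l + j], so this is the tail of [row_tuple]. *)
Definition distinct_tail : (r - 2 * l).-tuple 'I_d :=
  [tuple widen_ord hd (Ordinal (distinct_tail_subproof j)) | j < r - 2 * l].

Lemma row_tupleE (i j : 'I_r) :
  tnth row_tuple i = tnth row_tuple j <-> row_index l i = row_index l j.
Proof.
rewrite !tnth_mktuple; split=> [/(congr1 val) // | ij].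
exact/val_inj.
Qed.

Lemma row_tuple_paired : row_tuple \in paired_tuples distinct_tail.
Proof.
apply/(paired_tuplesP hl); split=> [i j /row_tupleE //|i j ij].
rewrite !tnth_mktuple; apply: val_inj; rewrite /= /row_index ij.
by case: ifP; lia.
Qed.

(** As b is constant on rows and b* separates them, positions sent by p into one row already share a
    row. Hence p fixes the tail and induces a permutation s of the rows of length 2; if q moves
    these rows by s, then [p o q^-1] is horizontal. *)
Lemma group_G_row_tuple (p : 'S_r) b : b \in paired_tuples distinct_tail ->
  perm_indices p b = row_tuple -> p \in group_G r l.
Proof.
case/(paired_tuplesP hl) => brow btail bp.
have bpE i : tnth b (p i) = tnth row_tuple i by rewrite -bp tnth_mktuple.
have [_ rtail] := paired_tuplesP hl _ _ row_tuple_paired.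
have row_p (i j : 'I_r) :
    row_index l (p i) = row_index l (p j) -> row_index l i = row_index l j.
  by move/brow; rewrite !bpE => /row_tupleE.
(* b and b* agree on the tail, so b* has the same value at [p^-1 i] and at i; the row of i is a
   singleton. *)
have p'fix (i : 'I_r) : 2 * l <= i -> p^-1%g i = i.
  move=> li; have jr : i - 2 * l < r - 2 * l by have := ltn_ord i; lia.
  have ij : i = 2 * l + Ordinal jr :> nat by rewrite /= subnKC.
  have: tnth row_tuple (p^-1%g i) = tnth row_tuple i.
    by rewrite -bpE permKV (btail _ _ ij) (rtail _ _ ij).
  move/row_tupleE => ri; apply/ord_inj; move: ri; rewrite /row_index.
  by have := ltn_ord (p^-1%g i); do 2?case: ifP; lia.
have pfix (i : 'I_r) : 2 * l <= i -> p i = i.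
  by move=> li; rewrite -{1}(p'fix i li) permKV.
have plt (i : 'I_r) : i < 2 * l -> p i < 2 * l.
  move=> il; rewrite ltnNge; apply/negP => li.
  by have := p'fix _ li; rewrite permK => pi; move: li; rewrite -pi leqNgt il.
have lr (k : 'I_l) : 2 * k < r by have := ltn_ord k; lia.
pose ev (k : 'I_l) := Ordinal (lr k).
(* s sends k to the row reached by the first entry of row k. *)
have sl k : (p (ev k))./2 < l.
  by have := plt (ev k); have := ltn_ord k => /=; lia.
have row_ev k : row_index l (p (ev k)) = (p (ev k))./2.
  by rewrite /row_index ifT // plt //=; have := ltn_ord k; lia.
have s_inj : injective (fun k => Ordinal (sl k)).
  move=> k m /(congr1 val) /= km; apply: val_inj => /=.
  have: row_index l (ev k) = row_index l (ev m).
    by apply: row_p; rewrite !row_ev.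
  rewrite /row_index /=; have := ltn_ord k; have := ltn_ord m.
  by do 2?case: ifP; lia.
pose s := perm s_inj.
(* p maps row k onto row s k: the row of p i is that of p (ev m) for some m, and b
   separates the rows of the p (ev m), so m is the row of i. *)
have s_row (i : 'I_r) (k : 'I_l) : i./2 = k -> (p i)./2 = s k.
  move=> ik; have il : i < 2 * l by have := ltn_ord k; lia.
  have pil := plt i il; have pl : (p i)./2 < l by lia.
  have [m sm] : exists m, s m = Ordinal pl.
    by exists (s^-1%g (Ordinal pl)); rewrite permKV.
  have sm' : (p (ev m))./2 = (p i)./2.
    by have := congr1 val sm; rewrite permE.
  have: row_index l (ev m) = row_index l i.
    by apply: row_p; rewrite row_ev sm' /row_index pil.
  rewrite /row_index il /= => mi.
  have -> : k = m.
    by apply: val_inj => /=; move: mi; have := ltn_ord m; case: ifP; lia.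
  by rewrite permE.
(* The formula of [row_permsP] for s, which becomes a permutation once shown injective. *)
pose q0 (i : 'I_r) : nat := if insub i./2 is Some k then 2 * s k + odd i else i.
have q0r i : q0 i < r.
  rewrite /q0; case: insubP => [k _ _|_] //.
  by have := ltn_ord (s k); case: (odd i); lia.
have q0_inj : injective (fun i => Ordinal (q0r i)).
  move=> i j /(congr1 val) /=; rewrite /q0 => ij; apply: val_inj => /=; move: ij.
  case: insubP => [k kl /= ik|kl]; case: insubP => [k' kl' /= ik'|kl'].
  - move=> E; have: s k = s k'.
      by apply: val_inj => /=; move: E; case: (odd i); case: (odd j); lia.
    move/perm_inj => kk; move: E ik; rewrite kk.
    by case oi: (odd i); case oj: (odd j); lia.
  - by have := ltn_ord (s k); case: (odd i); lia.
  - by have := ltn_ord (s k'); case: (odd j); lia.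
  - by [].
pose q := perm q0_inj.
have qE (i : 'I_r) : q i = q0 i :> nat by rewrite permE.
(* Composed from left to right, the horizontal factor is [p o q^-1]. It sends [q j] to [p j], and
   both lie in row [s j./2], or equal j on the tail. *)
apply/imset2P; exists (q^-1 * p)%g q; last by rewrite /perm_comp mulKVg.
  apply/(horizontal_permsP hl) => i; rewrite permM.
  have [j ->] : exists j, i = q j by exists (q^-1%g i); rewrite permKV.
  rewrite permK /row_index qE /q0; case: insubP => [k kl /= jk|kl].
    rewrite plt ?(s_row _ _ (esym jk)) //; last by lia.
    by have := ltn_ord (s k); case: (odd j); do 2?case: ifP; lia.
  by rewrite pfix //; lia.
by apply/(row_permsP hl); exists s.
Qed.

End DistinctRows.

(** * Coordinate tensors and their contraction *)

Section DualTensor.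
Variables (K : fieldType) (V : vectType K) (d : nat) (B : d.-tuple V) (r : nat).
Implicit Types (b : r.-tuple 'I_d).

(** The tensor product of the dual basis covectors selected by b. *)
Definition dual_tensor b (v : r.-tuple V) : K :=
  \prod_i coord B (tnth b i) (tnth v i).

Lemma dual_tensor_tensors b : tensors (dual_tensor b).
Proof.
move=> v i k x y; rewrite /dual_tensor.
have E u : \prod_j coord B (tnth b j) (tnth (set_arg v i u) j) =
    coord B (tnth b i) u * \prod_(j | j != i) coord B (tnth b j) (tnth v j).
  rewrite (bigD1 i) //= tnth_mktuple eqxx; congr (_ * _).
  by apply: eq_bigr => j /negPf ji; rewrite tnth_mktuple ji.
by rewrite !E linearP mulrDl -mulrA.
Qed.

Lemma dual_tensor_basis b b' : free B ->
  dual_tensor b (basis_vectors B b') = (b' == b)%:R.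
Proof.
move=> fB; have coordE i : coord B (tnth b i) (tnth (basis_vectors B b') i) =
    (tnth b' i == tnth b i)%:R.
  by rewrite tnth_mktuple (tnth_nth 0) coord_free.
rewrite /dual_tensor (eq_bigr _ (fun i _ => coordE i)).
have [->|/eqP bb'] := eqVneq b' b; first by apply: big1 => i _; rewrite eqxx.
have /existsP[i /negPf ni] : [exists i, tnth b' i != tnth b i].
  apply: contra_notT bb' => /existsPn bb'; apply: eq_from_tnth => i.
  exact/eqP/negPn/bb'.
by rewrite (bigD1 i) //= ni mul0r.
Qed.

End DualTensor.

(** The coefficient at p sums the signs of the paired b with [b o p = b*]. Such b exist only for p
    in G; then [perm_indices_imset] gives one and injectivity makes it unique. *)
Lemma contracted_dual_tensor (K : fieldType) (V : vectType K) (g : {symmetric V})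
    (d : nat) (B : d.-tuple V) (r l : nat) (hl : (2 * l <= r)%N)
    (hd : (r - l <= d)%N) : free B ->
  contracted_elt g B (distinct_tail hl hd) (dual_tensor B (row_tuple hl hd)) =
  pair_sign g B l (row_tuple hl hd) *: set_elt K (group_G r l).
Proof.
move=> fB; apply/ffunP => p; rewrite contracted_eltE ffunE set_eltE.
under eq_bigr do rewrite dual_tensor_basis //.
have bG b : b \in paired_tuples (distinct_tail hl hd) ->
    perm_indices p b = row_tuple hl hd -> p \in group_G r l.
  exact: group_G_row_tuple.
have [pG|pG] := boolP (p \in group_G r l); last first.
  rewrite [RHS]mulr0 big1 // => b bP.
  case: eqP => [/(bG _ bP)|_]; last by rewrite mulr0.
  by rewrite (negPf pG).
have := row_tuple_paired hl hd; rewrite -{1}(perm_indices_imset hl _ pG).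
case/imsetP => b bP bE; rewrite (bigD1 b) //= big1 => [|c /andP[_ /eqP cb]].
  by rewrite -bE eqxx addr0 -(pair_sign_perm _ _ hl pG bP) -bE.
case: eqP => [|_]; last by rewrite mulr0.
by rewrite bE => /perm_indices_inj.
Qed.

(** Replacing the abstract field K by [R] or [complex R] gives it a numeric structure, in which
    [pnatr_eq0] applies. *)
Lemma natr_neq0 (R : realType) (K : fieldType) (n : nat) :
  K = R :> fieldType \/ K = (complex R) :> fieldType ->
  (0 < n)%N -> n%:R != 0 :> K.
Proof. by case=> ->; rewrite Num.Theory.pnatr_eq0 -lt0n. Qed.

(** * The two inclusions over the real or complex field *)

Theorem theorem7p1 (R : realType) (K : fieldType)
    (hK : K = R :> fieldType \/ K = (complex R) :> fieldType)
    (V : vectType K) (g : {symmetric V}) (hg : nondegenerate g)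
    (d : nat) (B : d.-tuple V) (hB : orthonormal_basis g B)
    (r l : nat) (hl : (2 <= 2 * l <= r)%N)
    (e : group_ringS K r) (he : e * e = e) :
  let one_G := set_elt K (group_G r l) in
  let one_G_ideal : set (group_ringS K r) :=
     [set one_G * a * e | a in [set: group_ringS K r]]%classic in
  (forall b0 : (r - 2 * l).-tuple 'I_d,
     forall T : r.-tuple V -> K, symmetry_class (star_ideal e) T ->
       one_G_ideal (contracted_elt g B b0 T)) /\
  ((r - l <= \dim {:V})%N ->
     exists b0 : (r - 2 * l).-tuple 'I_d,
       one_G_ideal =
       linear_span
         [set contracted_elt g B b0 T
            | T in symmetry_class (star_ideal e)]%classic).
Proof.
move=> one_G one_G_ideal; have hlr : (2 * l <= r)%N by lia.
have nG : #|group_G r l|%:R != 0 :> K.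
  by apply: natr_neq0 hK _; apply/card_gt0P; exists 1%g; apply: group_G1.
have part1 (b0 : (r - 2 * l).-tuple 'I_d) T : symmetry_class (star_ideal e) T ->
    one_G_ideal (contracted_elt g B b0 T).
  by move=> /(contracted_elt_in_ideal g B hlr b0 nG)[a <-]; exists a.
split=> // dimV; have [Bbasis _ Bsign] := hB.
have dE : \dim {:V} = d by rewrite -(size_basis Bbasis).
have hd : (r - l <= d)%N by rewrite -dE.
pose b := row_tuple hlr hd; pose sg := pair_sign g B l b.
have sg0 : sg != 0.
  apply/prodf_neq0 => i _; case: (Bsign (tnth b i)) => ->;
    by rewrite ?oppr_eq0 oner_eq0.
exists (distinct_tail hlr hd); apply/seteqP.
split=> [_ [a _ <-]|_ [n [c [y [Sy ->]]]]].
  (* One generator suffices: [(a * e)^*] applied to the dual tensor of b* contracts to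
     [sg *: (one_G * a * e)], and [sg^-1] removes the sign. *)
  exists 1%N, (fun=> sg^-1); exists (fun=> sg *: (one_G * a * e)).
  split=> [_|]; last by rewrite big_ord1 scalerA mulVf ?scale1r.
  exists (gr_act (gr_star (a * e)) (dual_tensor B b)).
    exists (gr_star (a * e)); first by exists (a * e) => //; exists a.
    by exists (dual_tensor B b) => //; apply: dual_tensor_tensors.
  rewrite contracted_elt_act gr_starK contracted_dual_tensor ?(basis_free Bbasis) //.
  by rewrite -scalerAl mulrA.
(* By the first claim each generator has the form [one_G * a i * e], and this form is linear in
   [a i]. *)
have /choice[a aE] : forall i, exists a, one_G * a * e = y i.
  move=> i; have [T ST <-] := Sy i.
  by case: (part1 (distinct_tail hlr hd) T ST) => a _ <-; exists a.
exists (\sum_i c i *: a i) => //.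
rewrite mulr_sumr mulr_suml; apply: eq_bigr => i _.
by rewrite -aE -scalerAr -scalerAl.
Qed.
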